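(* Assume the game is strongly monotone (Assumption 1), that Assumption 2 holds, and that $\mathcal{D}_{\mathrm{act}}\neq\emptyset$ (Assumption 3), all as specified in the context. Let $(\mathbf z(t),\lambda(t),\Delta(t))$, $t\ge 0$, be a trajectory of the system $$\dot{\mathbf z}=-F\mathbf z-\mathbf r-A^\top\lambda-D\Delta,\qquad \dot\lambda=[A\mathbf z-\mathbf b]^+_{\lambda},\qquad \dot\Delta_v^i=[g^i(\mathbf z)]^+_{\lambda^i+\Delta_v^i}-[g^i(\mathbf z)]^+_{\lambda^i}\quad (v\in\{1,\dots,N\},\ i\in I_v)$$ from any initial condition $y_0=(\mathbf z(0),\lambda(0),\Delta(0))$ with $\lambda(0)\ge\mathbf 0$, $\Delta(0)\ge \mathbf 0$, and let $\bar\Delta_{[y_0]}:=\lim_{t\to\infty}\Delta(t)\ge\mathbf 0$ (this limit exists). If $\bar\Delta_{[y_0]}\in\mathcal{D}_{\mathrm{act}}$, with associated pair $(\mathbf z(\bar\Delta_{[y_0]}),\lambda(\bar\Delta_{[y_0]}))$, then $$(\mathbf z(t),\lambda(t))\to\big(\mathbf z(\bar\Delta_{[y_0]}),\lambda(\bar\Delta_{[y_0]})\big)\quad\text{as } t\to\infty,$$ and $\mathbf z(\bar\Delta_{[y_0]})$ is the generalized Nash equilibrium associated with $\bar\Delta_{[y_0]}$, i.e. it is a generalized Nash equilibrium of the game, satisfying the KKT system with the multipliers $\lambda_v^i=\lambda^i(\bar\Delta_{[y_0]})+(\bar\Delta_{[y_0]})_v^i$ for each agent $v$ and each $i\in I_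v$.
   Context: Game. There are $N$ agents; agent $v$ controls $z_v\in\mathbb R^{n_v}$; $\mathbf z\in\mathbb R^n$, $n=\sum_v n_v$, is the stacked vector and $\mathbf z_{-v}$ the stack of all decisions other than $z_v$. Agent $v$ has cost $f_v(z_v,\mathbf z_{-v})=z_v^\top \mathbf Q_v z_v+z_v^\top\mathbf P_v\mathbf z_{-v}+\mathbf r_v^\top z_v$ with $\mathbf Q_v\in\mathbb R^{n_v\times n_v}$, $\mathbf P_v\in\mathbb R^{n_v\times(n-n_v)}$, $\mathbf r_v\in\mathbb R^{n_v}$. The global constraints are $g(\mathbf z)=A\mathbf z-\mathbf b\le\mathbf 0$ with $A\in\mathbb R^{p\times n}$, $\mathbf b\in\mathbb R^p$; $g^i$ is the $i$-th component. Agent $v$ senses the rows relevant to it, a set $I_v\subseteq\{1,\dots,p\}$ of $m_v$ rows, which contains every row of $A$ having a nonzero entry in the columns belonging to $z_v$; every row is sensed by at least one agent; $m=\sum_v m_v\ge p$. Put $g_v(\mathbf z)=(g^i(\mathbf z))_{i\in I_v}$. Agent $v$ solves $\min_{z_v} f_v(z_v,\mathbf z_{-v})$ subject to $g_v(z_v,\mathbf z_{-v})\le\mathbf 0$. Pseudo-gradient. The matrix $F\in\mathbb R^{n\times n}$ and vector $\mathbf r\in\mathbb R^n$ are defined by $F\mathbf z+\mathbf r=$ the stack over $v$ of $\nabla_{z_v}f_v(\mathbf z)=(\mathbf Q_v+\mathbf Q_v^\top)z_v+\mathbf P_v\mathbf z_{-v}+\mathbf r_v$. Assumption 1 (strong monotonicity):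 there is $\delta>0$ with $x^\top Fx\ge\delta\|x\|^2$ for all $x\in\mathbb R^n$. Assumption 2: (i) $\mathbf Q_v+\mathbf Q_v^\top\succeq0$ for every $v$; (ii) for every player $v$ a suitable constraint qualification and the Linear Independence Constraint Qualification hold (at each feasible point, the gradients with respect to $z_v$ of the active components of $g_v$ are linearly independent), and $\operatorname{rank}(A)=p$. Equilibrium. A feasible $\mathbf z^\star$ is a generalized Nash equilibrium if for every $v$, $f_v(z_v^\star,\mathbf z_{-v}^\star)\le f_v(z_v,\mathbf z_{-v}^\star)$ for all $z_v$ with $g_v(z_v,\mathbf z_{-v}^\star)\le\mathbf 0$. KKT system: with $L_v(\mathbf z,\lambda_v)=f_v(\mathbf z)+g_v(\mathbf z)^\top\lambda_v$, for every $v$: $\nabla_{z_v}L_v(\mathbf z^\star,\lambda_v^\star)=\mathbf 0$ and $\mathbf 0\le\lambda_v^\star\perp g_v(\mathbf z^\star)\le\mathbf 0$. Projection bracket. For $a\in\mathbb R$, $b\ge0$: $[a]^+_b=a$ if $b>0$, and $[a]^+_b=\max\{0,a\}$ if $b=0$; applied componentwise to vectors. Dynamics. The variables are $\mathbf z\in\mathbb R^n$, $\lambda=(\lambda^i)_{i=1}^p$ and $\Delta=(\Delta_{[1]},\dots,\Delta_{[N]})\in\mathbb R^m$ with $\Delta_{[v]}=(\Delta_v^i)_{i\in I_v}$. $D\in\mathbb R^{n\times m}$ is block diagonal with $v$-th block $A(m_v,n_v)^\top$, where $A(m_v,n_v)$ is the submatrix of $A$ with rows $I_v$ and the columns of $z_v$.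 (This system comes from $\dot z_v=-\nabla_{z_v}L_v(\mathbf z,\lambda_v)$, $\dot\lambda_v=[g_v(\mathbf z)]^+_{\lambda_v}$, $\lambda_v(0)\ge \mathbf 0$, where for each $i$ the reference $\lambda^i$ is the copy $\lambda_v^i$ with smallest initial value and $\Delta_u^i=\lambda_u^i-\lambda^i$.) A trajectory is a locally absolutely continuous function on $[0,\infty)$ with $\lambda(t)\ge\mathbf 0$ and $\lambda^i(t)+\Delta_v^i(t)\ge0$ for all $t$, satisfying the equations for almost every $t$. When $\Delta_v^i\ge0$, the right-hand side for $\Delta_v^i$ equals $g^i(\mathbf z)$ if $\Delta_v^i>0$, $\lambda^i=0$, $g^i(\mathbf z)<0$, and equals $0$ otherwise. Admissible shifts. $\mathcal D_{\mathrm{act}}\subseteq\mathbb R^m_{\ge0}$ is the set of all $\hat\Delta\ge\mathbf 0$ for which there is an associated pair $(\mathbf z(\hat\Delta),\lambda(\hat\Delta))\in\mathbb R^n\times\mathbb R^p$ satisfying $F\mathbf z(\hat\Delta)+\mathbf r+A^\top\lambda(\hat\Delta)+D\hat\Delta=\mathbf 0$, $A\mathbf z(\hat\Delta)-\mathbf b=\mathbf 0$, $\lambda(\hat\Delta)\ge\mathbf 0$. *)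

(* Defs.v *)
From HB Require Import structures.
From mathcomp Require Import all_boot all_order all_algebra.
From mathcomp Require Import ring.
From mathcomp Require Import all_classical all_reals all_analysis.

Set Implicit Arguments.
Unset Strict Implicit.
Unset Printing Implicit Defensive.

Import Order.TTheory GRing.Theory Num.Theory.
Import numFieldNormedType.Exports.

Local Open Scope classical_set_scope.
Local Open Scope ring_scope.

Section Vectors.
Variable R : realType.

Definition nonneg m n (x : 'M[R]_(m, n)) : Prop := forall i j, 0 <= x i j.

Definition psd n (M : 'M[R]_n) : Prop :=
  forall x : 'cV[R]_n, 0 <= (x^T *m M *m x) 0 0.

(* [x^T *m x] is the squared Euclidean norm; the library norm on matrices is
   the sup norm. *)
Definition strongly_monotone n (M : 'M[R]_n) : Prop :=
  exists2 d : R, 0 < d &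
    forall x : 'cV[R]_n, d * (x^T *m x) 0 0 <= (x^T *m M *m x) 0 0.

Definition grad n (h : 'cV[R]_n -> R) (z : 'cV[R]_n) : 'cV[R]_n :=
  \col_j 'D_(delta_mx j 0) h z.

(* [a]^+_b; only meant for 0 <= b. *)
Definition bracket (a b : R) : R := if 0 < b then a else Num.max 0 a.

Definition abs_cont_on (V : normedModType R) (a b : R) (f : R -> V) : Prop :=
  forall e : R, 0 < e -> exists2 d : R, 0 < d &
    forall (k : nat) (s t : 'I_k -> R),
      (forall j, [/\ a <= s j, s j <= t j & t j <= b]) ->
      trivIset [set: 'I_k] (fun j => `]s j, t j[%classic) ->
      \sum_j (t j - s j) < d ->
      \sum_j `|f (t j) - f (s j)| < e.

Definition loc_abs_cont (V : normedModType R) (f : R -> V) : Prop :=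
  forall T : R, 0 < T -> abs_cont_on 0 T f.

End Vectors.

(* [lift v] enumerates the agents other than v in increasing order, so that the
   columns of [Pmat v] are those of z_{-v}.  [sensed v] is I_v. *)
Record game (R : realType) := Game {
  nagents : nat;
  ndec : 'I_nagents -> nat;
  ncstr : nat;
  Qmat : forall v, 'M[R]_(ndec v);
  Pmat : forall v, 'M[R]_(ndec v, \sum_(j < nagents.-1) ndec (lift v j));
  rvec : forall v, 'cV[R]_(ndec v);
  Amat : 'M[R]_(ncstr, \sum_v ndec v);
  bvec : 'cV[R]_ncstr;
  sensed : 'I_nagents -> {set 'I_ncstr};
  sensed_relevant : forall v i,
    row i (submxrow Amat v) != 0 -> i \in sensed v;
  sensed_by_some : forall i, exists v, i \in sensed v
}.

Section Game.
Variables (R : realType) (G : game R).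

Local Notation N := (nagents G).
Local Notation p := (ncstr G).
Local Notation ndec := (@ndec R G).
Local Notation n := (\sum_(v < N) ndec v)%N.
Local Notation Q := (@Qmat R G).
Local Notation P := (@Pmat R G).
Local Notation A := (Amat G).
Local Notation I := (@sensed R G).
Local Notation m := (\sum_(v < N) #|I v|)%N.

(* z_{-v}; stated for several columns at once so that it can also be applied
   to the identity matrix. *)
Definition others k (v : 'I_N) (z : 'M[R]_(n, k)) :
    'M[R]_(\sum_(j < N.-1) ndec (lift v j), k) :=
  \mxcol_j submxcol z (lift v j).

(* (x, z_{-v}) as a stacked vector. *)
Definition deviate (v : 'I_N) (x : 'cV[R]_(ndec v)) (z : 'cV[R]_n) :
    'cV[R]_n :=
  \mxcol_u eqtype.dfwith (fun u => submxcol z u) x u.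

Definition cost (v : 'I_N) (x : 'cV[R]_(ndec v))
    (y : 'cV[R]_(\sum_(j < N.-1) ndec (lift v j))) : R :=
  (x^T *m Q v *m x + x^T *m P v *m y + (rvec v)^T *m x) 0 0.

Definition fcost (v : 'I_N) (z : 'cV[R]_n) : R :=
  cost (submxcol z v) (others v z).

Definition pgrad (v : 'I_N) (h : 'cV[R]_n -> R) (z : 'cV[R]_n) :
    'cV[R]_(ndec v) := submxcol (grad h z) v.

Definition constr (z : 'cV[R]_n) : 'cV[R]_p := A *m z - bvec G.

(* The coordinates i \in I_v of x, in increasing order of i. *)
Definition local k (v : 'I_N) (x : 'M[R]_(p, k)) : 'M[R]_(#|I v|, k) :=
  rowsub enum_val x.

Definition lconstr (v : 'I_N) (z : 'cV[R]_n) : 'cV[R]_#|I v| :=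
  local v (constr z).

Definition feasible (z : 'cV[R]_n) : Prop := nonneg (- constr z).

Definition Fmat : 'M[R]_n :=
  \mxcol_v ((Q v + (Q v)^T) *m submxcol 1%:M v + P v *m others v 1%:M).

Definition rstack : 'cV[R]_n := \mxcol_v rvec v.

Lemma others_mul q (M : 'M[R]_(n, q)) k (w : 'M[R]_(q, k)) v :
  others v (M *m w) = others v M *m w.
Proof.
by apply/mxcolP => j; rewrite -submxcol_mul !mxcolK submxcol_mul.
Qed.

Lemma FmatE (z : 'cV[R]_n) v :
  submxcol (Fmat *m z + rstack) v =
  (Q v + (Q v)^T) *m submxcol z v + P v *m others v z + rvec v.
Proof.
rewrite submxcolD mxcolK -submxcol_mul mxcolK mulmxDl -!mulmxA.
by rewrite submxcol_mul -others_mul mul1mx.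
Qed.

Lemma derive_quad k (h : 'cV[R]_k -> R) (z d : 'cV[R]_k) (L q : R) :
  (forall e : R, h (e *: d + z) = h z + e * L + e ^+ 2 * q) ->
  'D_d h z = L.
Proof.
move=> hE; rewrite /derive.
apply: cvg_lim => //.
have : (fun e : R => L + e * q) @ (0 : R)^' --> L.
  rewrite -[X in _ --> X]addr0; apply: cvgD; first exact: cvg_cst.
  rewrite -[X in _ --> X](mul0r q); apply: cvgMr_tmp.
  exact: nbhs_dnbhs.
apply: cvg_trans; apply: near_eq_cvg.
near=> e.
have e0 : e != 0 by near: e; apply: nbhs_dnbhs_neq.
rewrite /= hE /GRing.scale /=; field.
Unshelve. all: by end_near. Qed.

Lemma pgrad_fcost (z : 'cV[R]_n) v :
  pgrad v (fcost v) z =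
  (Q v + (Q v)^T) *m submxcol z v + P v *m others v z + rvec v.
Proof.
apply/matrixP => i o; rewrite (ord1 o) {o} [LHS]mxE [LHS]mxE.
set d : 'cV[R]_n := delta_mx _ 0.
have dE u k o : submxcol d u k o =
    (existT (fun w => 'I_(ndec w)) u k == existT _ v i)%:R.
  rewrite !mxE (ord1 o) andbT -(can_eq (@tagnat.sigK _ _)).
  by rewrite !tagnat.rankK.
have dv : submxcol d v = delta_mx i 0.
  apply/matrixP => k o; rewrite dE mxE (ord1 o) andbT; congr (_%:R).
  by rewrite [X in nat_of_bool X](@eq_Tagged _ (fun w => 'I_(ndec w))
    (existT _ v k) i).
have dy : others v d = 0.
  rewrite /others; apply/mxcolP => u; rewrite mxcolK submxcol0.
  apply/matrixP => k o; rewrite dE mxE -tag_eqE /tag_eq /=.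
  by rewrite [_ == v]eq_sym (negbTE (neq_lift v u)).
set x := submxcol z v; set y := others v z.
apply: (derive_quad (q := ((delta_mx i 0)^T *m Q v *m delta_mx i 0) 0 0)) => e.
rewrite /fcost /cost.
have -> : submxcol (e *: d + z) v = e *: delta_mx i 0 + x.
  by rewrite submxcolD -dv; congr (_ + _); apply/matrixP => k o; rewrite !mxE.
have -> : others v (e *: d + z) = y.
  rewrite -[e *: d + z]mul1mx others_mul mulmxDr -scalemxAr -!others_mul.
  by rewrite !mul1mx dy scaler0 add0r.
rewrite -/x -/y.
set c := delta_mx i 0.
have tr1 (M : 'M[R]_1) : M^T 0 0 = M 0 0 by rewrite mxE.
have cE (w : 'cV[R]_(ndec v)) : w i 0 = (c^T *m w) 0 0.
  by rewrite trmx_delta -rowE mxE.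
have aE (M M' : 'M[R]_1) : (M + M') 0 0 = M 0 0 + M' 0 0 by rewrite mxE.
have sE (a : R) (M : 'M[R]_1) : (a *: M) 0 0 = a * M 0 0 by rewrite mxE.
have QE : (c^T *m (Q v)^T *m x) 0 0 = (x^T *m Q v *m c) 0 0.
  by rewrite -tr1 !trmx_mul !trmxK mulmxA.
have rE : (c^T *m rvec v) 0 0 = ((rvec v)^T *m c) 0 0.
  by rewrite -tr1 trmx_mul trmxK.
have tE : (e *: c + x)^T = e *: c^T + x^T.
  by apply/matrixP => k o; rewrite !mxE.
rewrite cE tE !(mulmxDl, mulmxDr).
rewrite -!(scalemxAl, scalemxAr) !mulmxA.
rewrite !(aE, sE) QE rE; ring.
Qed.

(* The defining property of F and r. *)
Lemma FmatP (z : 'cV[R]_n) :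
  Fmat *m z + rstack = \mxcol_v pgrad v (fcost v) z.
Proof.
by apply/mxcolP => v; rewrite FmatE mxcolK pgrad_fcost.
Qed.

(* The block (v, u) of D is nonzero only for u = v, where it is the transpose
   of the submatrix of A with rows I_v and the columns of z_v. *)
Definition Dmat : 'M[R]_(n, m) :=
  \mxblock_(v, u) (if v == u then (local u (submxrow A v))^T else 0).

Definition active (v : 'I_N) (z : 'cV[R]_n) : {set 'I_p} :=
  [set i in I v | constr z i 0 == 0]%SET.

Definition LICQ (v : 'I_N) : Prop :=
  forall z, feasible z ->
    free [seq pgrad v (fun w => constr w i 0) z | i <- enum (active v z)].

Definition GNE (z : 'cV[R]_n) : Prop :=
  feasible z /\
  forall (v : 'I_N) (x : 'cV[R]_(ndec v)),
    nonneg (- lconstr v (deviate x z)) ->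
    cost (submxcol z v) (others v z) <= cost x (others v z).

Definition lagrangian (v : 'I_N) (z : 'cV[R]_n) (l : 'cV[R]_#|I v|) : R :=
  fcost v z + ((lconstr v z)^T *m l) 0 0.

Definition KKT (z : 'cV[R]_n) (l : forall v, 'cV[R]_#|I v|) : Prop :=
  forall v : 'I_N,
    [/\ pgrad v (fun w => lagrangian w (l v)) z = 0,
        nonneg (l v),
        nonneg (- lconstr v z)
      & ((l v)^T *m lconstr v z) 0 0 = 0].

Definition dyn_z (z : 'cV[R]_n) (l : 'cV[R]_p) (D : 'cV[R]_m) : 'cV[R]_n :=
  - (Fmat *m z) - rstack - A^T *m l - Dmat *m D.

Definition dyn_lambda (z : 'cV[R]_n) (l : 'cV[R]_p) : 'cV[R]_p :=
  map2_mx (@bracket R) (constr z) l.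

Definition dyn_Delta (z : 'cV[R]_n) (l : 'cV[R]_p) (D : 'cV[R]_m) :
    'cV[R]_m :=
  \mxcol_v (map2_mx (@bracket R) (lconstr v z) (local v l + submxcol D v)
            - map2_mx (@bracket R) (lconstr v z) (local v l)).

(* Only the values at t >= 0 are constrained. *)
Definition trajectory (z : R -> 'cV[R]_n) (l : R -> 'cV[R]_p)
    (D : R -> 'cV[R]_m) : Prop :=
  [/\ [/\ loc_abs_cont z, loc_abs_cont l & loc_abs_cont D],
      forall t, 0 <= t -> nonneg (l t),
      forall t, 0 <= t -> forall v, nonneg (local v (l t) + submxcol (D t) v)
    & {ae (@lebesgue_measure R), forall t : R, 0 < t ->
        [/\ is_derive t 1 z (dyn_z (z t) (l t) (D t)),
            is_derive t 1 l (dyn_lambda (z t) (l t))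
          & is_derive t 1 D (dyn_Delta (z t) (l t) (D t))]}].

Definition shift_pair (D : 'cV[R]_m) (z : 'cV[R]_n) (l : 'cV[R]_p) : Prop :=
  [/\ Fmat *m z + rstack + A^T *m l + Dmat *m D = 0,
      constr z = 0
    & nonneg l].

Definition Dact : set 'cV[R]_m :=
  [set D | nonneg D /\ exists z l, shift_pair D z l].

End Game.

Arguments Dact {R} G.

(* Main.v *)
Require Import Defs.
From mathcomp Require Import all_boot all_order all_algebra.
From mathcomp Require Import ring lra.
From mathcomp Require Import all_classical all_reals all_analysis.
From mathcomp Require Import measurable_realfun.

Set Implicit Arguments.
Unset Strict Implicit.
Unset Printing Implicit Defensive.

Import Order.TTheory GRing.Theory Num.Theory.
Import numFieldNormedType.Exports.

Local Open Scope classical_set_scope.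
Local Open Scope ring_scope.

(** Each component of Delta stays nonnegative: below zero its derivative is
    nonnegative, because the bracket [g]^+_b is nonincreasing in b >= 0. For the
    same reason it is nonincreasing where it is nonnegative, so Delta has a
    limit Dbar >= 0 (Delta_cvg).

    Suppose that Dbar has an associated pair (zbar, lbar), and put
    x = z - zbar, mu = lambda - lbar and w = D (Delta - Dbar), which tends to 0.
    All constraints are tight at zbar, so that g(z) = A x and
      x' = - F x - A^T mu - w,   mu' = [A x]^+_lambda.
    The energy (|x|^2 + |mu|^2) / 2 alone gives decay in x only, and the
    perturbation w need not be integrable. The cross term eps <A x, mu> adds
    - eps |A^T mu|^2 to the derivative; the projection does no harm, since
    mu . [A x]^+ <= mu . A x and (A x) . [A x]^+ <= |A x|^2. As A has
    independent rows, |A^T mu| controls |mu|, and for small eps the function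
    V = (|x|^2 + |mu|^2) / 2 + eps <A x, mu> is equivalent to |x|^2 + |mu|^2
    and satisfies V' <= - c V + C |w|^2 almost everywhere (lyapunov_decay).
    Hence V tends to 0 (dissipative_eventually_le), which is the convergence
    of (z, lambda) (primal_dual_cvg).

    Since trajectories satisfy the equations only almost everywhere, both
    arguments rest on the fact that an absolutely continuous function whose
    derivative is nonnegative almost everywhere is nondecreasing
    (abs_cont_ge0_derive_le).

    Finally, each agent senses every constraint in which it appears, so the
    block of A^T lbar + D Dbar belonging to agent v is the transpose of its own
    rows applied to its multipliers lbar + Dbar (multiplier_block). The equation
    of the pair is thus the stationarity of all Lagrangians, complementarity is
    trivial, and the KKT system is sufficient because each cost is convex in
    the variable of its agent (KKT_GNE). *)

(** * Monotonicity of absolutely continuous functions *)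

(** A transitive relation on the points of a segment that holds on both sides
    of each point at small scale holds between the endpoints (Cousin's
    lemma). *)
Lemma cousin {R : realType} (P : R -> R -> Prop) (a b : R) :
  a <= b ->
  (forall x y w, a <= x -> x <= y -> y <= w -> w <= b ->
     P x y -> P y w -> P x w) ->
  (forall t, a <= t -> t <= b -> exists2 d : R, 0 < d &
     (forall x, a <= x -> x <= t -> t - x < d -> P x t) /\
     (forall y, t <= y -> y <= b -> y - t < d -> P t y)) ->
  P a b.
Proof.
move=> ab Ptrans Ploc.
pose S := [set x | [/\ a <= x, x <= b & P a x]].
have Sa : S a.
  split=> //; have [d d0 [+ _]] := Ploc a (lexx a) ab.
  by apply; rewrite ?subrr.
have supS : has_sup S.
  by split; [exists a | exists b => x []].
set c := sup S.
have ac : a <= c by apply: ub_le_sup Sa; exact: supS.2.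
have cb : c <= b by apply: ge_sup; [exists a | move=> x []].
have [d d0 [Pl Pr]] := Ploc c ac cb.
have Pac : P a c.
  have [x [ax xb Pax] cx] := sup_adherent d0 supS.
  have xc : x <= c by apply: ub_le_sup => //; exact: supS.2.
  by apply: (Ptrans a x c) => //; apply: Pl => //; rewrite ltrBlDr -ltrBlDl.
have [cltb|] := ltP c b; last first.
  by move=> bc; have -> : b = c by apply/eqP; rewrite eq_le bc cb.
pose y := Num.min b (c + d / 2).
have cy : c < y by rewrite lt_min cltb ltrDl divr_gt0.
have yb : y <= b by rewrite ge_min lexx.
have yd : y - c < d.
  rewrite ltrBlDl; apply: (@le_lt_trans _ _ (c + d / 2)).
    by rewrite ge_min lexx orbT.
  by rewrite ltrD2l ltr_pdivrMr// ltr_pMr// ltr1n.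
have Sy : S y.
  split=> //; first exact: le_trans ac (ltW cy).
  by apply: (Ptrans a c y) => //; [exact: ltW | apply: Pr => //; exact: ltW].
by have := ub_le_sup (proj2 supS) Sy; rewrite leNgt cy.
Qed.

(** Disjoint open intervals inside an open set have total length at most its
    measure. *)
Lemma sum_itv_le_measure {R : realType} (U : set R) (k : nat)
    (s t : 'I_k -> R) :
  open U -> (forall j, s j <= t j) ->
  (forall j, `]s j, t j[ `<=` U) ->
  trivIset [set: 'I_k] (fun j => `]s j, t j[%classic) ->
  ((\sum_j (t j - s j))%:E <= lebesgue_measure U)%E.
Proof.
move=> oU st stU triv.
have -> : ((\sum_j (t j - s j))%:E =
    \sum_(j < k) lebesgue_measure `]s j, t j[%classic)%E.
  rewrite -sumEFin; apply: eq_bigr => j _.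
  rewrite lebesgue_measure_itv /= lte_fin EFinB.
  by case: ltgtP (st j) => // -> _; rewrite subee.
rewrite -(measure_semi_additive_ord (lebesgue_measure (R := R)))//; last first.
  by apply: bigsetU_measurable => j _; exact: measurable_itv.
apply: le_measure.
- by rewrite inE; apply: bigsetU_measurable => j _; exact: measurable_itv.
- by rewrite inE; exact: open_measurable.
- by elim/big_ind : _ => // X Y XU YU; rewrite subUset.
Qed.

Lemma is_derive_slope {R : realType} (f : R -> R) (t k e : R) :
  is_derive t 1 f k -> 0 < e -> exists2 d : R, 0 < d &
    forall y, `|y - t| < d -> `|f y - f t - k * (y - t)| <= e * `|y - t|.
Proof.
move=> [df dk] e0.
have : h^-1 *: (f (h + t) - f t) @[h --> 0^'] --> k.
  have := (cvg_ex _).1 df => -[l hl].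
  suff -> : k = l by move: hl; under eq_fun do rewrite [_%:A]mulr1.
  rewrite -dk; apply: cvg_lim => //.
move=> /cvgrPdist_lt /(_ _ e0) [d /= d0 dP].
exists d => // y yt.
have [->|ynt] := eqVneq y t; first by rewrite !subrr mulr0 subrr normr0 mulr0.
have yt0 : y - t != 0 by rewrite subr_eq0.
have := dP (y - t); rewrite /= sub0r normrN subrK => /(_ yt yt0).
rewrite /GRing.scale/= => /ltW.
rewrite -[X in _ -> _ <= X]mulrC -ler_pdivrMl ?normr_gt0//.
rewrite -normfV -normrM distrC; congr (`|_| <= _).
by rewrite [RHS]mulrBr [_^-1 * (k * _)]mulrCA mulVf// mulr1.
Qed.

(** Cousin's lemma splits [a, b] into small intervals. Those placed at a point
    with nonnegative derivative contribute almost no decrease; the other points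
    lie in a null set, covered by an open set so small that absolute continuity
    bounds the total variation there. *)
Lemma abs_cont_ge0_derive_le {R : realType} (f : R -> R) (a b : R) :
  a <= b -> abs_cont_on a b f ->
  {ae (@lebesgue_measure R), forall t : R, a < t -> t < b ->
     exists2 k : R, 0 <= k & is_derive t 1 f k} ->
  f a <= f b.
Proof.
move=> ab fac fae.
suff H (e : R) : 0 < e -> f a <= f b + e * (b - a) + e.
  apply/ler_addgt0Pr => e e0.
  have q0 : 0 < b - a + 1 by rewrite ltr_wpDl ?subr_ge0.
  have := H (e / (b - a + 1)) (divr_gt0 e0 q0).
  rewrite -addrA -[X in _ + (_ + X)]mulr1 -mulrDr -mulrA mulVf ?gt_eqF//.
  by rewrite mulr1.
move=> e0; have [d d0 dP] := fac e e0.
(* The bad points: no nonnegative derivative. The endpoints may be bad too. *)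
pose B := [set t : R | ~ exists2 k : R, 0 <= k & is_derive t 1 f k] `&` `[a, b].
have [M [mM M0 BM]] : (@lebesgue_measure R).-negligible B.
  have n1 (c : R) : (@lebesgue_measure R).-negligible [set c].
    by exists [set c]; split => //; rewrite lebesgue_measure_set1.
  have nab := negligibleU (n1 a) (n1 b).
  apply: negligibleS (negligibleU fae nab) => t [/= nt].
  rewrite in_itv/= => /andP[]; rewrite !le_eqVlt.
  move=> /predU1P[->|aT] /predU1P[->|tb]; try by right; auto.
  by left => /=; move=> /(_ aT tb).
have [|U [oU MU UM]] := @lebesgue_regularity_outer R M d mM _ d0.
  by rewrite [X in (X < _)%E]M0 ltry.
have Ud : (lebesgue_measure U < d%:E)%E.
  have mU : measurable U by exact: open_measurable.
  rewrite -(setDUK MU) measureU//; last 2 first.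
  - exact: measurableD.
  - by rewrite setDIK.
  by rewrite [X in (X + _)%E]M0 add0e.
pose ok x y (p : R * R) :=
  [/\ x <= p.1, p.1 <= p.2, p.2 <= y & `]p.1, p.2[ `<=` U].
(* Across [x, y] the function f decreases by at most e (y - x) plus its
   variation over finitely many disjoint intervals contained in U. *)
pose good x y := exists s : seq (R * R),
  [/\ forall p, p \in s -> ok x y p,
      pairwise (fun p q => p.2 <= q.1) s
    & f x <= f y + e * (y - x) + \sum_(p <- s) `|f p.2 - f p.1|].
have good0 x y : f x <= f y + e * (y - x) -> good x y.
  by move=> H; exists [::]; split => //; rewrite big_nil addr0.
have : good a b.
  apply: cousin => // [x y w ax xy yw wb [s1 [ok1 pw1 H1]] [s2 [ok2 pw2 H2]]|].
    exists (s1 ++ s2); split.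
    - move=> p; rewrite mem_cat => /orP[/ok1|/ok2] [? ? ? ?]; split => //.
        exact: le_trans yw.
      exact: le_trans xy _.
    - rewrite pairwise_cat pw1 pw2 !andbT; apply/allrelP => p q.
      by move=> /ok1[_ _ py _] /ok2[yq _ _ _]; exact: le_trans py yq.
    - rewrite big_cat /=.
      move: (\sum_(p <- s1) _) (\sum_(p <- s2) _) H1 H2 => S1 S2 H1 H2.
      lra.
  move=> t at_ tb.
  have [[k k0 fk]|nt] := pselect (exists2 k : R, 0 <= k & is_derive t 1 f k).
    have [r r0 rP] := is_derive_slope fk e0.
    exists r => //; split=> [x ax xt|y ty yb] txr; apply: good0.
      have /rP : `|x - t| < r by rewrite distrC ger0_norm// subr_ge0.
      rewrite (ler0_norm (x := x - t)) ?subr_le0// ler_norml => /andP[_].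
      have : k * (x - t) <= 0 by rewrite mulr_ge0_le0// subr_le0.
      lra.
    have /rP : `|y - t| < r by rewrite ger0_norm// subr_ge0.
    rewrite (ger0_norm (x := y - t)) ?subr_ge0// ler_norml => /andP[+ _].
    have : 0 <= k * (y - t) by rewrite mulr_ge0// subr_ge0.
    lra.
  have Ut : U t by apply/MU/BM; split => //=; rewrite in_itv/= at_ tb.
  have [r /= r0 rU] : nbhs_ball t U by apply/nbhs_ballP; exact: open_nbhs_nbhs.
  exists r => //; split=> [x ax xt|y ty yb] txr.
    exists [:: (x, t)]; split => //.
    - move=> p; rewrite inE => /eqP -> /=; split=> //= u.
      rewrite /= in_itv/= => /andP[xu ut]; apply: rU.
      by rewrite /ball/= ger0_norm; lra.
    - rewrite big_seq1 /= -subr_ge0.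
      have := ler_norm (- (f t - f x)); rewrite normrN.
      have : 0 <= e * (t - x) by rewrite mulr_ge0 ?subr_ge0// ltW.
      lra.
  exists [:: (t, y)]; split => //.
  - move=> p; rewrite inE => /eqP -> /=; split=> //= u.
    rewrite /= in_itv/= => /andP[xu ut]; apply: rU.
    by rewrite /ball/= ltr0_norm; lra.
  - rewrite big_seq1 /= -subr_ge0.
    have := ler_norm (- (f y - f t)); rewrite normrN.
    have : 0 <= e * (y - t) by rewrite mulr_ge0 ?subr_ge0// ltW.
    lra.
move=> [s [oks pws fab]]; apply: le_trans fab _; rewrite lerD2l.
rewrite (big_nth (0, 0)) big_mkord.
have oki (i : 'I_(size s)) : ok a b (nth (0, 0) s i) by apply/oks/mem_nth.
have triv : trivIset [set: 'I_(size s)]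
    (fun j => `](nth (0, 0) s j).1, (nth (0, 0) s j).2[%classic).
  move=> i j _ _ [u [/=]]; rewrite !in_itv/= => /andP[iu ui] /andP[ju uj].
  have /(pairwiseP (0, 0)) pw := pws.
  apply/val_inj/eqP; case: ltngtP => // ij.
    by have := pw _ _ (ltn_ord i) (ltn_ord j) ij => /=; lra.
  by have := pw _ _ (ltn_ord j) (ltn_ord i) ij => /=; lra.
apply/ltW/dP => //.
- by move=> j; have [] := oki j.
- rewrite -lte_fin; apply: le_lt_trans Ud.
  apply: sum_itv_le_measure => // j; by have [] := oki j.
Qed.

(** * Calculus of absolutely continuous functions *)

Lemma ae_lebesgue_impl {R : realType} (P Q : R -> Prop) :
  (forall t, P t -> Q t) ->
  {ae (@lebesgue_measure R), forall t : R, P t} ->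
  {ae (@lebesgue_measure R), forall t : R, Q t}.
Proof. by move=> PQ; apply: negligibleS => t nQ /PQ. Qed.

Lemma abs_cont_on_sub {R : realType} {V : normedModType R} (f : R -> V)
    (a b a' b' : R) :
  a <= a' -> b' <= b -> abs_cont_on a b f -> abs_cont_on a' b' f.
Proof.
move=> aa' b'b fac e e0; have [d d0 dP] := fac e e0.
exists d => // k s t st; apply: dP => j; have [as_ st_ tb] := st j.
by split=> //; [exact: le_trans as_ | exact: le_trans b'b].
Qed.

Lemma abs_cont_on_unif {R : realType} {V : normedModType R} (f : R -> V)
    (a b e : R) :
  abs_cont_on a b f -> 0 < e -> exists2 d : R, 0 < d &
    forall s t, a <= s -> s <= t -> t <= b -> t - s < d -> `|f t - f s| < e.
Proof.
move=> fac e0; have [d d0 dP] := fac e e0.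
exists d => // s t as_ st tb std.
have := dP 1%N (fun=> s) (fun=> t); rewrite !big_ord1; apply => //.
by move=> i j _ _ _; rewrite !ord1.
Qed.

Lemma abs_cont_on_bounded {R : realType} {V : normedModType R} (f : R -> V)
    (a b : R) :
  a <= b -> abs_cont_on a b f ->
  exists2 K : R, 0 <= K & forall t, a <= t -> t <= b -> `|f t| <= K.
Proof.
move=> ab fac.
have [d d0 dP] := abs_cont_on_unif fac ltr01.
pose P x y := exists2 K : R, 0 <= K &
  forall t, x <= t -> t <= y -> `|f t| <= K.
apply: (cousin (P := P)) => // [x y w _ _ _ _ [K K0 HK] [L L0 HL]|t at_ tb].
  exists (K + L) => [|t xt tw]; first exact: addr_ge0.
  have [ty|/ltW yt] := leP t y.
    by apply: le_trans (HK _ xt ty) _; rewrite lerDl.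
  by apply: le_trans (HL _ yt tw) _; rewrite lerDr.
exists d => //; split=> y.
  move=> ay yt tyd; exists (`|f t| + 1); first by rewrite addr_ge0.
  move=> u yu ut; rewrite -[f u](subrK (f t)) addrC.
  apply: le_trans (ler_normD _ _) _; rewrite lerD2l distrC ltW//.
  by apply: dP => //; [exact: le_trans yu | lra].
move=> ty yb ytd; exists (`|f t| + 1); first by rewrite addr_ge0.
move=> u tu uy; rewrite -[f u](subrK (f t)) addrC.
apply: le_trans (ler_normD _ _) _; rewrite lerD2l ltW//.
by apply: dP => //; [exact: le_trans yb | lra].
Qed.

Lemma abs_cont_on_dominated {R : realType} {U V W : normedModType R}
    (f : R -> U) (g : R -> V) (h : R -> W) (a b K : R) :
  0 <= K ->
  (forall s t, a <= s -> s <= t -> t <= b ->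
     `|f t - f s| <= K * (`|g t - g s| + `|h t - h s|)) ->
  abs_cont_on a b g -> abs_cont_on a b h -> abs_cont_on a b f.
Proof.
move=> K0 fgh gac hac e e0.
have K1 : 0 < K + 1 by rewrite ltr_wpDl.
have e20 : 0 < e / (K + 1) / 2 by rewrite !divr_gt0.
have [d1 d10 d1P] := gac _ e20; have [d2 d20 d2P] := hac _ e20.
exists (Num.min d1 d2); first by rewrite lt_min d10.
move=> k s t st triv; rewrite lt_min => /andP[sd1 sd2].
apply: (@le_lt_trans _ _
  (K * \sum_j (`|g (t j) - g (s j)| + `|h (t j) - h (s j)|))).
  by rewrite mulr_sumr; apply: ler_sum => j _; have [? ? ?] := st j; exact: fgh.
rewrite big_split /=.
have := d1P _ _ _ st triv sd1; have := d2P _ _ _ st triv sd2.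
have : 0 <= \sum_j `|g (t j) - g (s j)| by exact: sumr_ge0.
have : 0 <= \sum_j `|h (t j) - h (s j)| by exact: sumr_ge0.
move: (\sum_j `|g _ - _|) (\sum_j `|h _ - _|) => x y y0 x0 ye xe.
have xye : x + y < e / (K + 1) by lra.
apply: (@le_lt_trans _ _ ((K + 1) * (x + y))).
  by rewrite ler_wpM2r ?addr_ge0// lerDl.
by rewrite mulrC -ltr_pdivlMr.
Qed.

Section AbsContReal.
Context {R : realType} (a b : R).
Implicit Types f g : R -> R.

Lemma abs_cont_on_cst (c : R) : abs_cont_on a b (fun=> c).
Proof.
move=> e e0; exists 1 => // k s t _ _ _.
by rewrite big1// => j _; rewrite subrr normr0.
Qed.

Lemma abs_cont_on_id : abs_cont_on a b (fun t : R => t).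
Proof.
move=> e e0; exists e => // k s t st _ ste.
rewrite (eq_bigr (fun j => t j - s j))// => j _.
by rewrite ger0_norm// subr_ge0; have [] := st j.
Qed.

Lemma abs_cont_onD f g :
  abs_cont_on a b f -> abs_cont_on a b g -> abs_cont_on a b (f \+ g).
Proof.
apply: (abs_cont_on_dominated (K := 1)) => // s t _ _ _.
by rewrite mul1r /= opprD addrACA ler_normD.
Qed.

Lemma abs_cont_onM f g : a <= b ->
  abs_cont_on a b f -> abs_cont_on a b g -> abs_cont_on a b (f \* g).
Proof.
move=> ab fac gac.
have [K K0 fK] := abs_cont_on_bounded ab fac.
have [L L0 gL] := abs_cont_on_bounded ab gac.
apply: (abs_cont_on_dominated (K := K + L)) fac gac => [|s t as_ st tb].
  exact: addr_ge0.
have -> : (f \* g) t - (f \* g) s = (f t - f s) * g s + f t * (g t - g s).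
  by rewrite /=; ring.
apply: le_trans (ler_normD _ _) _; rewrite !normrM.
have sb := le_trans st tb; have at_ := le_trans as_ st.
have := ler_wpM2l (normr_ge0 (f t - f s)) (gL _ as_ sb).
have := ler_wpM2r (normr_ge0 (g t - g s)) (fK _ at_ tb).
have := mulr_ge0 K0 (normr_ge0 (f t - f s)).
have := mulr_ge0 L0 (normr_ge0 (g t - g s)).
lra.
Qed.

Lemma abs_cont_onZ (c : R) f : a <= b ->
  abs_cont_on a b f -> abs_cont_on a b (fun t => c * f t).
Proof. by move=> ab; apply: abs_cont_onM => //; exact: abs_cont_on_cst. Qed.

Lemma abs_cont_on_sum (I : Type) (r : seq I) (F : I -> R -> R) :
  (forall i, abs_cont_on a b (F i)) ->
  abs_cont_on a b (fun t => \sum_(i <- r) F i t).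
Proof.
move=> Fac; elim: r => [|i r IH].
  by under eq_fun do rewrite big_nil; exact: abs_cont_on_cst.
by under eq_fun do rewrite big_cons; exact: (abs_cont_onD (Fac i) IH).
Qed.

End AbsContReal.

(** * Barriers and comparison *)

(** An absolutely continuous function cannot cross a level upwards if its
    derivative is nonpositive at almost every point above that level. *)
Lemma abs_cont_barrier {R : realType} (f : R -> R) (a b c : R) :
  a <= b -> abs_cont_on a b f -> f a <= c ->
  {ae (@lebesgue_measure R), forall t : R, a < t -> t < b -> c < f t ->
     exists2 k : R, k <= 0 & is_derive t 1 f k} ->
  f b <= c.
Proof.
move=> ab fac fa fae; rewrite leNgt; apply/negP => cfb.
(* On ]s, b], s being the last point where f is at most c, f exceeds c and is
   therefore nonincreasing. *)
pose S := [set x | [/\ a <= x, x <= b & f x <= c]].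
have Sa : S a by [].
have supS : has_sup S by split; [exists a | exists b => x []].
set s := sup S.
have as_ : a <= s by apply: ub_le_sup Sa; exact: supS.2.
have sb : s <= b by apply: ge_sup; [exists a | move=> x []].
have fs : f s <= c.
  apply/ler_addgt0Pr => e e0.
  have [d d0 dP] := abs_cont_on_unif fac e0.
  have [x [ax xb fx] sx] := sup_adherent d0 supS.
  have xs : x <= s by apply: ub_le_sup => //; exact: supS.2.
  have := dP x s ax xs sb; rewrite -/s in sx; rewrite ltrBlDr -ltrBlDl.
  by move=> /(_ sx); rewrite ltr_norml => /andP[_]; lra.
have above t : s < t -> t <= b -> c < f t.
  move=> st tb; rewrite ltNge; apply/negP => ft.
  suff : t <= s by rewrite leNgt st.
  apply: ub_le_sup; first exact: supS.2.
  by split=> //; exact: le_trans (ltW st).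
suff : f b <= f s by rewrite leNgt (le_lt_trans fs cfb).
rewrite -lerN2.
apply: (@abs_cont_ge0_derive_le _ (fun t => - f t)) => //.
  have := abs_cont_on_sub as_ (lexx b) fac.
  move=> /(abs_cont_onZ (-1) sb); under eq_fun do rewrite mulN1r; exact.
apply: ae_lebesgue_impl fae => t ft st tb.
have [|k k0 fk] := ft _ tb (above _ st (ltW tb)).
  exact: le_lt_trans st.
by exists (- k); [rewrite oppr_ge0 | exact: is_deriveN].
Qed.

(** Comparison principle: V' <= - c V + w almost everywhere with w vanishing at
    infinity forces V to be eventually below any positive level. *)
Lemma dissipative_eventually_le {R : realType} (V w : R -> R) (c e : R) :
  0 < c -> 0 < e ->
  (forall T, 0 < T -> abs_cont_on 0 T V) ->
  w t @[t --> +oo] --> 0 ->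
  {ae (@lebesgue_measure R), forall t : R, 0 < t ->
     exists2 k : R, k <= - (c * V t) + w t & is_derive t 1 V k} ->
  \forall t \near +oo, V t <= e.
Proof.
move=> c0 e0 Vac w0 Vae.
have ce0 : 0 < c * e / 2 by rewrite divr_gt0// mulr_gt0.
move/cvgrPdist_lt : w0 => /(_ _ ce0) [T0' [_ wT0]].
pose T0 := Num.max T0' 1.
have T00 : 0 < T0 by rewrite lt_max ltr01 orbT.
have VacT a b : 0 <= a -> abs_cont_on a b V.
  move=> a0; apply: abs_cont_on_sub a0 _ (Vac (Num.max b 1) _).
    by rewrite le_max lexx.
  by rewrite lt_max ltr01 orbT.
(* Beyond T0, the function decreases at rate at least c e / 2 above level e. *)
have dec t : T0 < t -> e < V t -> forall k, k <= - (c * V t) + w t ->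
    k <= - (c * e / 2).
  move=> T0t eV k /le_trans; apply.
  have T0't : T0' < t by apply: le_lt_trans T0t; rewrite le_max lexx.
  have := wT0 _ T0't; rewrite /= sub0r normrN => /ltW; rewrite ler_norml.
  have : c * e <= c * V t by rewrite ler_pM2l// ltW.
  by move=> cV /andP[_]; lra.
(* Such a decrease cannot last forever, so level e is reached at some t1; *)
have [t1 T0t1 Vt1] : exists2 t1, T0 <= t1 & V t1 <= e.
  apply: contrapT => nV.
  have eV t : T0 <= t -> e < V t.
    by move=> T0t; rewrite ltNge; apply/negP => Vt; apply: nV; exists t.
  have VT0 : e < V T0 by exact: eV.
  pose L := V T0 / (c * e / 2).
  have L0 : 0 <= L by rewrite divr_ge0 ?ltW//; exact: lt_trans VT0.
  pose f t := - V t - (c * e / 2) * t.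
  have : f T0 <= f (T0 + L).
    have T0L : T0 <= T0 + L by rewrite lerDl.
    apply: abs_cont_ge0_derive_le => //.
      rewrite (_ : f = (fun t => -1 * V t) \+ (fun t => - (c * e / 2) * t)).
        apply: abs_cont_onD; apply: abs_cont_onZ => //.
          exact/VacT/ltW.
        exact: abs_cont_on_id.
      by apply/funext => t; rewrite /f /= mulN1r mulNr.
    apply: ae_lebesgue_impl Vae => t Vt T0t tL.
    have [|k kV Vk] := Vt; first exact: lt_trans T0t.
    exists (- k - (c * e / 2)).
      by have := dec t T0t (eV _ (ltW T0t)) _ kV; lra.
    have := is_deriveB (is_deriveN Vk)
      (is_deriveZ (c * e / 2) (is_derive_id t (1 : R))).
    by rewrite [_ *: 1]mulr1; exact.
  rewrite /f mulrDr [_ * L]mulrC mulfVK ?gt_eqF//.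
  have := eV (T0 + L); rewrite lerDl => /(_ L0); lra.
(* from then on it is never crossed upwards. *)
exists t1; split=> [|t /ltW t1t]; first exact: num_real.
apply: (@abs_cont_barrier _ V t1) => //.
  by apply: VacT; apply: le_trans T0t1; exact: ltW.
apply: ae_lebesgue_impl Vae => u Vu t1u _ eVu.
have T0u : T0 < u by exact: le_lt_trans t1u.
have [|k kV Vk] := Vu; first exact: lt_trans T0u.
exists k => //; apply: le_trans (dec _ T0u eVu _ kV) _.
by rewrite oppr_le0 ltW.
Qed.

(** * Euclidean inner product on column vectors *)

Section Dot.
Context {R : realType}.

(** The Euclidean inner product of two column vectors. *)
Definition dot n (u v : 'cV[R]_n) : R := (u^T *m v) 0 0.

Lemma dotE n (u v : 'cV[R]_n) : dot u v = \sum_i u i 0 * v i 0.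
Proof. by rewrite /dot mxE; apply: eq_bigr => i _; rewrite mxE. Qed.

Lemma dotC n (u v : 'cV[R]_n) : dot u v = dot v u.
Proof. by rewrite !dotE; apply: eq_bigr => i _; rewrite mulrC. Qed.

Lemma dotDr n (u v w : 'cV[R]_n) : dot u (v + w) = dot u v + dot u w.
Proof. by rewrite /dot mulmxDr mxE. Qed.

Lemma dotZr n (c : R) (u v : 'cV[R]_n) : dot u (c *: v) = c * dot u v.
Proof. by rewrite /dot -scalemxAr mxE. Qed.

Lemma dotNr n (u v : 'cV[R]_n) : dot u (- v) = - dot u v.
Proof. by rewrite -scaleN1r dotZr mulN1r. Qed.

Lemma dotBr n (u v w : 'cV[R]_n) : dot u (v - w) = dot u v - dot u w.
Proof. by rewrite dotDr dotNr. Qed.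

Lemma dotDl n (u v w : 'cV[R]_n) : dot (u + v) w = dot u w + dot v w.
Proof. by rewrite !(dotC _ w) dotDr. Qed.

Lemma dotNl n (u v : 'cV[R]_n) : dot (- u) v = - dot u v.
Proof. by rewrite !(dotC _ v) dotNr. Qed.

Lemma dotBl n (u v w : 'cV[R]_n) : dot (u - v) w = dot u w - dot v w.
Proof. by rewrite dotDl dotNl. Qed.

Lemma dotZl n (c : R) (u v : 'cV[R]_n) : dot (c *: u) v = c * dot u v.
Proof. by rewrite !(dotC _ v) dotZr. Qed.

Lemma dot0l n (u : 'cV[R]_n) : dot 0 u = 0.
Proof. by rewrite /dot trmx0 mul0mx mxE. Qed.

Lemma dot_trmul m n (M : 'M[R]_(m, n)) u v :
  dot u (M^T *m v) = dot (M *m u) v.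
Proof. by rewrite /dot trmx_mul mulmxA. Qed.

Lemma dot_ge0 n (u : 'cV[R]_n) : 0 <= dot u u.
Proof. by rewrite dotE sumr_ge0// => i _; rewrite -expr2 sqr_ge0. Qed.

Lemma sqr_coord_le_dot n (u : 'cV[R]_n) i : u i 0 ^+ 2 <= dot u u.
Proof.
rewrite dotE (bigD1 i)//= expr2 lerDl sumr_ge0// => j _.
by rewrite -expr2 sqr_ge0.
Qed.

Lemma cauchy_schwarz n (u v : 'cV[R]_n) : dot u v ^+ 2 <= dot u u * dot v v.
Proof.
have [v0|vn0] := eqVneq (dot v v) 0.
  suff -> : v = 0 by rewrite /dot !mulmx0 !mxE mulr0 expr0n.
  apply/colP => i; rewrite mxE; apply/eqP; rewrite -sqrf_eq0 eq_le sqr_ge0.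
  by rewrite andbT -v0 sqr_coord_le_dot.
have vp : 0 < dot v v by rewrite lt_neqAle eq_sym vn0 dot_ge0.
have := dot_ge0 (dot v v *: u - dot u v *: v).
have -> : dot (dot v v *: u - dot u v *: v) (dot v v *: u - dot u v *: v) =
    dot v v * (dot u u * dot v v - dot u v ^+ 2).
  by rewrite dotBl !dotBr !dotZl !dotZr (dotC v u); ring.
by rewrite pmulr_rge0// subr_ge0.
Qed.

Lemma young n (s : R) (u v : 'cV[R]_n) :
  0 < s -> 2 * dot u v <= s * dot u u + s^-1 * dot v v.
Proof.
move=> s0; have sn0 := gt_eqF s0.
have := dot_ge0 (s *: u - v).
have -> : dot (s *: u - v) (s *: u - v) =
    s * (s * dot u u + s^-1 * dot v v - 2 * dot u v).
  by rewrite dotBl !dotBr !dotZl !dotZr (dotC v u); field; rewrite sn0.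
by rewrite pmulr_rge0// subr_ge0.
Qed.

Lemma mulmx_bounded m n (M : 'M[R]_(m, n)) : exists2 K : R, 0 <= K &
  forall u : 'cV[R]_n, dot (M *m u) (M *m u) <= K * dot u u.
Proof.
exists (\sum_i dot (row i M)^T (row i M)^T) => [|u].
  by apply: sumr_ge0 => i _; exact: dot_ge0.
rewrite dotE mulr_suml; apply: ler_sum => i _.
have -> : (M *m u) i 0 = dot (row i M)^T u.
  by rewrite /dot trmxK -row_mul [in RHS]mxE.
by rewrite -expr2 cauchy_schwarz.
Qed.

Lemma norm_le_dot n (u : 'cV[R]_n) (e : R) :
  0 <= e -> dot u u <= e ^+ 2 -> `|u| <= e.
Proof.
move=> e0 ue; rewrite [leLHS]/Num.Def.normr/= mx_normrE.
apply: bigmax_le => // -[i j] _ /=; rewrite (ord1 j).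
rewrite -(ler_sqr (x := `|_|)) ?nnegrE// -normrX ger0_norm ?sqr_ge0//.
exact: le_trans (sqr_coord_le_dot u i) ue.
Qed.

End Dot.

(** * Vector-valued functions through their coordinates *)

Section CoordinateCalculus.
Context {R : realType}.

Lemma is_derive_coord m n (u : R -> 'M[R]_(m, n)) (t : R) du i j :
  is_derive t 1 u du -> is_derive t 1 (fun s => u s i j) (du i j).
Proof.
move=> [ud <-]; split; first by move/derivable_mxP : ud; exact.
by rewrite derive_mx// mxE.
Qed.

Lemma is_derive_dot n (u v : R -> 'cV[R]_n) (t : R) du dv :
  is_derive t 1 u du -> is_derive t 1 v dv ->
  is_derive t 1 (fun s => dot (u s) (v s)) (dot du (v t) + dot (u t) dv).
Proof.
move=> ud vd.
have -> : (fun s => dot (u s) (v s)) =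
    \sum_i (fun s => u s i 0) * (fun s => v s i 0).
  by apply/funext => s; rewrite dotE fct_sumE.
have -> : dot du (v t) + dot (u t) dv =
    \sum_i (u t i 0 *: dv i 0 + v t i 0 *: du i 0).
  rewrite !dotE -big_split; apply: eq_bigr => i _.
  by rewrite /GRing.scale/= addrC [du i 0 * _]mulrC.
apply: is_derive_sum => i; apply: is_deriveM; exact: is_derive_coord.
Qed.

Lemma is_derive_mulmx m n (M : 'M[R]_(m, n)) (u : R -> 'cV[R]_n) (t : R) du :
  is_derive t 1 u du -> is_derive t 1 (fun s => M *m u s) (M *m du).
Proof.
move=> ud.
have cd i : is_derive t 1 (fun s => (M *m u s) i 0) ((M *m du) i 0).
  have rowE (w : 'cV[R]_n) : (M *m w) i 0 = dot (row i M)^T w.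
    by rewrite /dot trmxK -row_mul [in RHS]mxE.
  under eq_fun do rewrite rowE; rewrite rowE.
  have := is_derive_dot (is_derive_cst (row i M)^T t (1 : R)) ud.
  by rewrite dot0l add0r.
have Md : derivable (fun s => M *m u s) t 1.
  by apply/derivable_mxP => i j; rewrite (ord1 j); case: (cd i).
split=> //; rewrite derive_mx//; apply/matrixP => i j; rewrite (ord1 j) mxE.
by case: (cd i).
Qed.

Lemma is_derive_shift (V : normedModType R) (u : R -> V) (c : V) (t : R) du :
  is_derive t 1 u du -> is_derive t 1 (fun s => u s - c) du.
Proof.
move=> ud; have := is_deriveB ud (is_derive_cst c t (1 : R)).
by rewrite subr0; exact.
Qed.

Variables (a b : R) (ab : a <= b).

Lemma abs_cont_on_coord m n (u : R -> 'M[R]_(m, n)) i j :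
  abs_cont_on a b u -> abs_cont_on a b (fun s => u s i j).
Proof.
move=> uac; apply: (abs_cont_on_dominated (K := 1) _ _ uac uac) => // s t _ _ _.
rewrite mul1r; apply: (@le_trans _ _ `|u t - u s|); last by rewrite lerDl.
rewrite [leRHS]/Num.Def.normr/= mx_normrE.
have -> : u t i j - u s i j = (u t - u s) i j by rewrite !mxE.
exact: (le_bigmax _ (fun ij => `|(u t - u s) ij.1 ij.2|) (i, j)).
Qed.

Lemma abs_cont_on_dot n (u v : R -> 'cV[R]_n) :
  (forall i, abs_cont_on a b (fun s => u s i 0)) ->
  (forall i, abs_cont_on a b (fun s => v s i 0)) ->
  abs_cont_on a b (fun s => dot (u s) (v s)).
Proof.
move=> uac vac; under eq_fun do rewrite dotE.
apply: (abs_cont_on_sum _ (F := fun i s => u s i 0 * v s i 0)) => i.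
exact: (abs_cont_onM ab (uac i) (vac i)).
Qed.

Lemma abs_cont_on_mulmx m n (M : 'M[R]_(m, n)) (u : R -> 'cV[R]_n) i :
  (forall i, abs_cont_on a b (fun s => u s i 0)) ->
  abs_cont_on a b (fun s => (M *m u s) i 0).
Proof.
move=> uac; under eq_fun do rewrite mxE.
apply: (abs_cont_on_sum _ (F := fun j s => M i j * u s j 0)) => j.
exact: (abs_cont_onZ _ ab (uac j)).
Qed.

Lemma cvg_mx (T : Type) (F : set_system T) (FF : Filter F) m n
    (u : T -> 'M[R]_(m, n)) (l : 'M[R]_(m, n)) :
  (forall i j, u t i j @[t --> F] --> l i j) -> u t @[t --> F] --> l.
Proof.
move=> ul; apply/cvgrPdist_le => /= e e0; near=> t.
rewrite [leLHS]/Num.Def.normr/= mx_normrE (bigmax_le _ (ltW e0))//= => i _.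
rewrite !mxE/=.
move: i; near: t; apply: filter_forall => /= i.
exact: ((cvgrPdist_le _ _).1 (ul i.1 i.2)).
Unshelve. all: by end_near. Qed.

Lemma cvg_coord (T : Type) (F : set_system T) (FF : Filter F) m n
    (u : T -> 'M[R]_(m, n)) (l : 'M[R]_(m, n)) i j :
  u t @[t --> F] --> l -> u t i j @[t --> F] --> l i j.
Proof.
move=> ul; apply: (cvg_comp u (fun M : 'M[R]_(m, n) => M i j) ul).
exact: coord_continuous.
Qed.

Lemma cvg_dot (T : Type) (F : set_system T) (FF : Filter F) n
    (u v : T -> 'cV[R]_n) (l k : 'cV[R]_n) :
  u t @[t --> F] --> l -> v t @[t --> F] --> k ->
  dot (u t) (v t) @[t --> F] --> dot l k.
Proof.
move=> ul vk; under eq_fun do rewrite dotE; rewrite dotE.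
apply: cvg_big => [|i _]; first exact: add_continuous.
by apply: cvgM; exact: cvg_coord.
Qed.

End CoordinateCalculus.

(** * The projection bracket *)

Section Bracket.
Context {R : realType}.
Implicit Types g l d : R.

(** Either the bracket is inactive, or the multiplier vanishes and the bracket
    is the projection of g on the nonnegative numbers. *)
Lemma bracketP g l : 0 <= l ->
  [/\ 0 < l & bracket g l = g] \/ [/\ l = 0, 0 <= bracket g l,
    g <= bracket g l & bracket g l * (bracket g l - g) = 0].
Proof.
rewrite /bracket le_eqVlt => /predU1P[<-|l0]; [right|by left; rewrite l0].
rewrite ltxx; split=> //; first by rewrite le_max lexx.
  by rewrite le_max lexx orbT.
by case: (leP 0 g) => _; rewrite ?subrr ?mulr0 ?mul0r.
Qed.

Lemma bracket_mul_diff_le g l lbar : 0 <= l -> 0 <= lbar ->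
  (l - lbar) * bracket g l <= (l - lbar) * g.
Proof.
move=> l0 lb0; have [[_ ->//]|[-> _ gb _]] := bracketP g l0.
by rewrite sub0r !mulNr lerN2 ler_wpM2l.
Qed.

Lemma mul_bracket_le g l : 0 <= l -> g * bracket g l <= g * g.
Proof.
move=> l0; have [[_ ->//]|[_ b0 gb bg0]] := bracketP g l0.
have := sqr_ge0 (bracket g l - g); nra.
Qed.

Lemma bracket_ge g l : g <= bracket g l.
Proof. by rewrite /bracket; case: ifP => // _; rewrite le_max lexx orbT. Qed.

(** The bracket is nonincreasing in its multiplier. *)
Lemma bracket_shift_le g l d : 0 <= l -> 0 <= d ->
  bracket g (l + d) <= bracket g l.
Proof.
move=> l0; rewrite le_eqVlt => /predU1P[<-|d0]; first by rewrite addr0.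
by rewrite {1}/bracket ltr_wpDl// bracket_ge.
Qed.

End Bracket.

(** * A strict Lyapunov function for the primal-dual flow *)

Section Lyapunov.
Context {R : realType}.

(** The energy of the deviation (x, mu) of a primal-dual pair from its limit,
    with a cross term of weight eps that makes its decay strict in mu. *)
Definition lyapunov n p (A : 'M[R]_(p, n)) (eps : R) (x : 'cV[R]_n)
    (mu : 'cV[R]_p) : R :=
  (dot x x + dot mu mu) / 2 + eps * dot (A *m x) mu.

(** The multiplier mu is controlled by A^T mu since the rows of A are
    independent. *)
Lemma dot_le_trmul n p (A : 'M[R]_(p, n)) : row_free A ->
  exists2 K : R, 0 <= K & forall mu : 'cV[R]_p,
    dot mu mu <= K * dot (A^T *m mu) (A^T *m mu).
Proof.
move=> /row_freeP[B AB]; have [K K0 HK] := mulmx_bounded B^T.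
exists K => // mu; have := HK (A^T *m mu).
by rewrite mulmxA -trmx_mul AB trmx1 mul1mx.
Qed.

(** Strict decay of the energy along x' = - F x - A^T mu - w, mu' = g, where the
    two hypotheses on g are those that the bracket of A x satisfies. *)
Lemma lyapunov_decay n p (F : 'M[R]_n) (A : 'M[R]_(p, n)) :
  strongly_monotone F -> row_free A ->
  exists eps c C : R, [/\ 0 < c, 0 <= C,
    forall x mu, (dot x x + dot mu mu) / 4 <= lyapunov A eps x mu
    & forall x mu w g (dx := - (F *m x) - A^T *m mu - w),
      dot mu g <= dot mu (A *m x) ->
      dot (A *m x) g <= dot (A *m x) (A *m x) ->
      dot x dx + dot mu g + eps * (dot (A *m dx) mu + dot (A *m x) g) <=
      - (c * lyapunov A eps x mu) + C * dot w w].
Proof.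
move=> [d d0 Fd] /dot_le_trmul[KB KB0 HB].
have [KF KF0 HF] := mulmx_bounded F; have [KA KA0 HA] := mulmx_bounded A.
pose E := 2 + 2 * KA + 4 * (KF + KA) / d.
have Ed0 : 0 <= 4 * (KF + KA) / d.
  by rewrite divr_ge0 ?mulr_ge0 ?addr_ge0// ltW.
have E0 : 0 < E by rewrite /E; lra.
pose eps := E^-1; have eps0 : 0 < eps by rewrite invr_gt0.
have epsE : eps * E = 1 by rewrite mulVf// gt_eqF.
have eA0 : 0 <= eps * KA by rewrite mulr_ge0// ltW.
have eFA0 : 0 <= eps * (4 * (KF + KA) / d) by rewrite mulr_ge0// ltW.
have epsS : 2 * eps + 2 * (eps * KA) + eps * (4 * (KF + KA) / d) = 1.
  by rewrite -[RHS]epsE /E; move: (4 * _ / d) (eps) => q e; ring.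
(* The smallness of eps, in the three forms used below. *)
have eps1 : eps <= 1 / 2 by lra.
have epsA : eps * KA <= 1 / 2 by lra.
have epsF : eps * (KF + KA) <= d / 4.
  have : eps * (4 * (KF + KA) / d) <= 1 by lra.
  by rewrite !mulrA ler_pdivrMr// => ?; lra.
(* c (|x|^2 + |mu|^2) <= d/2 |x|^2 + eps/2 |A^T mu|^2. *)
pose c := Num.min (d / 2) (eps / (2 * (KB + 1))).
have KB1 : 0 < 2 * (KB + 1) by lra.
have c0 : 0 < c by rewrite lt_min !divr_gt0.
have cd : c <= d / 2 by rewrite ge_min lexx.
have cB : c * KB <= eps / 2.
  have : c <= eps / (2 * (KB + 1)) by rewrite ge_min lexx orbT.
  by rewrite ler_pdivlMr//; lra.
(* The cross term is at most half of the quadratic part. *)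
have cross x mu : `|eps * dot (A *m x) mu| <= (dot x x + dot mu mu) / 4.
  have y1 := young (A *m x) mu ltr01; have y2 := young (A *m x) (- mu) ltr01.
  rewrite !dotNr dotNl in y2; rewrite invr1 !mul1r opprK in y1 y2.
  rewrite normrM (gtr0_norm eps0).
  have h1 : `|dot (A *m x) mu| <= (KA * dot x x + dot mu mu) / 2.
    by have := HA x; rewrite ler_norml; lra.
  have := ler_wpM2l (ltW eps0) h1.
  have := ler_wpM2r (dot_ge0 x) epsA; have := ler_wpM2r (dot_ge0 mu) eps1.
  lra.
exists eps, c, (d^-1 + eps); split => //.
- by rewrite addr_ge0// ?invr_ge0 ltW.
- by move=> x mu; have := cross x mu; rewrite ler_norml /lyapunov; lra.
move=> x mu w g dx mug xg.
have Fx : d * dot x x <= dot x (F *m x) by have := Fd x; rewrite /dot mulmxA.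
have -> : dot x dx = - dot x (F *m x) - dot mu (A *m x) - dot x w.
  by rewrite /dx !dotBr dotNr dot_trmul [dot mu _]dotC.
set y := A^T *m mu.
have -> : dot (A *m dx) mu = - dot (F *m x) y - dot y y - dot w y.
  by rewrite -dot_trmul /dx !dotBl dotNl.
(* Young's inequality absorbs every mixed product into -d/2 |x|^2 and
   -eps/2 |A^T mu|^2, up to a multiple of |w|^2. *)
have d20 : 0 < d / 2 by rewrite divr_gt0.
have yx := young x (- w) d20; have yF := young (- (F *m x)) y (ltr0n R 2).
have yw := young (- w) y (ltr0n R 2).
rewrite !(dotNl, dotNr) opprK invf_div in yx.
rewrite !(dotNl, dotNr) opprK in yF; rewrite !(dotNl, dotNr) opprK in yw.
have HFx := HF x; have HAx := HA x; have HBm := HB mu; rewrite -/y in HBm.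
have x0 := dot_ge0 x; have m0 := dot_ge0 mu; have y0 := dot_ge0 y.
have ly : lyapunov A eps x mu <= dot x x + dot mu mu.
  by have := cross x mu; rewrite ler_norml /lyapunov; lra.
have ly' := ler_wpM2l (ltW c0) ly.
have cx := ler_wpM2r x0 cd; have cy := ler_wpM2r y0 cB.
have cm := ler_wpM2l (ltW c0) HBm.
have inner : - dot (F *m x) y - dot y y - dot w y + dot (A *m x) g <=
    (KF + KA) * dot x x - dot y y / 2 + dot w w by lra.
have einner := ler_wpM2l (ltW eps0) inner.
have eFx := ler_wpM2r x0 epsF.
have yx' : - dot x w <= d / 4 * dot x x + d^-1 * dot w w by lra.
lra.
Qed.

End Lyapunov.

(** * Convergence of the primal-dual flow *)

Section Convergence.
Context {R : realType}.

Lemma loc_abs_cont_shift (V : normedModType R) (f : R -> V) (c : V) :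
  loc_abs_cont f -> loc_abs_cont (fun t => f t - c).
Proof.
move=> fac T T0.
have fT := fac T T0.
apply: (abs_cont_on_dominated (K := 1) _ _ fT fT) => // s t _ _ _.
by rewrite mul1r opprB addrA subrK lerDl.
Qed.

(** If all constraints are tight at the limit and the perturbation w vanishes
    at infinity, the projected primal-dual flow converges. *)
Lemma primal_dual_cvg n p (F : 'M[R]_n) (A : 'M[R]_(p, n))
    (z w : R -> 'cV[R]_n) (l : R -> 'cV[R]_p) zbar lbar :
  strongly_monotone F -> row_free A ->
  loc_abs_cont z -> loc_abs_cont l ->
  (forall t, 0 <= t -> nonneg (l t)) -> nonneg lbar ->
  w t @[t --> +oo] --> (0 : 'cV[R]_n) ->
  {ae (@lebesgue_measure R), forall t : R, 0 < t ->
    is_derive t 1 z (- (F *m (z t - zbar)) - A^T *m (l t - lbar) - w t) /\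
    is_derive t 1 l (map2_mx (@bracket R) (A *m (z t - zbar)) (l t))} ->
  z t @[t --> +oo] --> zbar /\ l t @[t --> +oo] --> lbar.
Proof.
move=> Fmon Afree zac lac l0 lbar0 w0 dyn.
have [eps [c [C [c0 C0 Vge Vdecay]]]] := lyapunov_decay Fmon Afree.
pose x t := z t - zbar; pose mu t := l t - lbar.
pose V t := lyapunov A eps (x t) (mu t).
have xac : loc_abs_cont x by exact: loc_abs_cont_shift.
have muac : loc_abs_cont mu by exact: loc_abs_cont_shift.
have Vac T : 0 < T -> abs_cont_on 0 T V.
  move=> T0; have T0' := ltW T0.
  have xc i := abs_cont_on_coord i 0 (xac T T0).
  have mc i := abs_cont_on_coord i 0 (muac T T0).
  have Axc i := abs_cont_on_mulmx T0' A i xc.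
  have := abs_cont_onD
    (abs_cont_onZ 2^-1 T0' (abs_cont_onD (abs_cont_on_dot T0' xc xc)
                                         (abs_cont_on_dot T0' mc mc)))
    (abs_cont_onZ eps T0' (abs_cont_on_dot T0' Axc mc)).
  by under eq_fun do rewrite /= mulrC; exact.
have Cw0 : C * dot (w t) (w t) @[t --> +oo] --> 0.
  rewrite -(mulr0 C) -(dot0l (0 : 'cV[R]_n)).
  by apply: cvgMl_tmp; exact: cvg_dot.
have Vae : {ae (@lebesgue_measure R), forall t : R, 0 < t ->
    exists2 k : R, k <= - (c * V t) + C * dot (w t) (w t) & is_derive t 1 V k}.
  apply: ae_lebesgue_impl dyn => t Ht t0; have [zd ld] := Ht t0.
  set g := map2_mx _ _ _ in ld.
  set dx := - (F *m _) - _ - _ in zd.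
  have {}zd : is_derive t 1 x dx by exact: is_derive_shift.
  have {}ld : is_derive t 1 mu g by exact: is_derive_shift.
  exists (dot (x t) dx + dot (mu t) g
      + eps * (dot (A *m dx) (mu t) + dot (A *m x t) g)).
    apply: Vdecay; rewrite !dotE; apply: ler_sum => i _; rewrite [g _ _]mxE.
      have -> : mu t i 0 = l t i 0 - lbar i 0 by rewrite !mxE.
      by apply: bracket_mul_diff_le => //; exact: l0 (ltW t0) _ _.
    by apply: mul_bracket_le; exact: l0 (ltW t0) _ _.
  have H := is_deriveD
    (is_deriveZ 2^-1 (is_deriveD (is_derive_dot zd zd) (is_derive_dot ld ld)))
    (is_deriveZ eps (is_derive_dot (is_derive_mulmx A zd) ld)).
  have -> : V = 2^-1 \*: ((fun s => dot (x s) (x s))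
      + (fun s => dot (mu s) (mu s)))
      + eps \*: (fun s => dot (A *m x s) (mu s)).
    by apply/funext => s; rewrite /V /lyapunov mulrC.
  apply: is_derive_eq H _; rewrite /GRing.scale/=.
  by rewrite (dotC dx) (dotC g); field.
have small e : 0 < e -> \forall t \near +oo, V t <= e ^+ 2 / 4.
  move=> e0; apply: dissipative_eventually_le c0 _ Vac Cw0 Vae.
  by rewrite divr_gt0// exprn_gt0.
split; apply/cvgrPdist_le => e e0; near=> t;
  have Vt : V t <= e ^+ 2 / 4 by [near: t; exact: small];
  have := le_trans (Vge _ _) Vt; rewrite distrC;
  have := dot_ge0 (x t); have := dot_ge0 (mu t) => mu0 x0 Vx;
  apply: norm_le_dot (ltW e0) _; rewrite -/(x t) -/(mu t); lra.
Unshelve. all: by end_near. Qed.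

End Convergence.

(** * The consensus errors *)

Lemma nonincreasing_ge0_cvg {R : realType} (f : R -> R) :
  (forall s t, 0 <= s -> s <= t -> f t <= f s) ->
  (forall t, 0 <= t -> 0 <= f t) ->
  exists2 L : R, 0 <= L & f t @[t --> +oo] --> L.
Proof.
move=> fdec f0; pose g t := - f (Num.max t 0).
have max0 (t : R) : 0 <= Num.max t 0 by rewrite le_max lexx orbT.
have gcvg : g t @[t --> +oo] --> sup (range g).
  apply: nondecreasing_cvgr => [s t st|].
    by rewrite lerN2; apply: fdec => //; rewrite ge_max le_max st max0.
  by exists 0 => _ [t _ <-]; rewrite oppr_le0 f0.
have fcvg : f t @[t --> +oo] --> - sup (range g).
  apply: cvg_trans (cvgN gcvg); apply: near_eq_cvg; near=> t.
  by rewrite /g /= opprK max_l.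
exists (- sup (range g)) => //; rewrite oppr_ge0.
by apply: ge_sup => [|_ [t _ <-]]; [exists (g 0), 0 | rewrite oppr_le0 f0].
Unshelve. all: by end_near. Qed.

Section ConsensusErrors.
Context {R : realType} {G : game R}.
Variables (z : R -> 'cV[R]_(\sum_(v < nagents G) ndec v))
  (lambda : R -> 'cV[R]_(ncstr G))
  (Delta : R -> 'cV[R]_(\sum_(v < nagents G) #|sensed v|)).
Hypotheses (traj : trajectory z lambda Delta) (Delta0 : nonneg (Delta 0)).

(** The equation of one component of Delta; i is the constraint to which the
    component j refers. *)
Lemma dyn_DeltaE (x : 'cV[R]_(\sum_(v < nagents G) ndec v)) l D j
    (i := enum_val (tagnat.sig2 j)) :
  dyn_Delta x l D j 0 =
  bracket (constr x i 0) (l i 0 + D j 0) - bracket (constr x i 0) (l i 0).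
Proof. by rewrite !mxE tagnat.sig2K. Qed.

Let Delta_ac j (T : R) : 0 < T -> abs_cont_on 0 T (fun t => Delta t j 0).
Proof.
move=> T0; case: traj => -[_ _ Dac] _ _ _.
exact: abs_cont_on_coord (Dac T T0).
Qed.

Let Delta_ae j : {ae (@lebesgue_measure R), forall t : R, 0 < t ->
  exists2 k : R, is_derive t 1 (fun t => Delta t j 0) k &
    (0 <= Delta t j 0 -> k <= 0) /\ (Delta t j 0 < 0 -> 0 <= k)}.
Proof.
case: traj => _ l0 lD0; apply: ae_lebesgue_impl => t Ht t0.
have [_ _ Dd] := Ht t0.
exists (dyn_Delta (z t) (lambda t) (Delta t) j 0); first exact: is_derive_coord.
rewrite dyn_DeltaE; set i := enum_val _; set g := constr _ _ _.
have li : 0 <= lambda t i 0 by exact: l0 (ltW t0) _ _.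
have lDi : 0 <= lambda t i 0 + Delta t j 0.
  by have := lD0 t (ltW t0) _ (tagnat.sig2 j) 0; rewrite !mxE tagnat.sig2K.
split=> [D0|/ltW D0]; first by rewrite subr_le0 bracket_shift_le.
rewrite subr_ge0 -[X in bracket g X <= _](addrK (Delta t j 0)).
by apply: bracket_shift_le; rewrite // oppr_ge0.
Qed.

Lemma Delta_nonneg t : 0 <= t -> nonneg (Delta t).
Proof.
rewrite le_eqVlt => /predU1P[<-//|t0] j o; rewrite (ord1 o) -oppr_le0.
apply: (@abs_cont_barrier _ (fun t => - Delta t j 0) 0); first exact: ltW.
- have := abs_cont_onZ (-1) (ltW t0) (Delta_ac j t0).
  by under eq_fun do rewrite mulN1r; exact.
- by rewrite oppr_le0.
apply: ae_lebesgue_impl (Delta_ae j) => s Hs s0 _; rewrite oppr_gt0 => Ds.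
have [k Dk [_ /(_ Ds) k0]] := Hs s0.
by exists (- k); [rewrite oppr_le0 | exact: is_deriveN Dk].
Qed.

Lemma Delta_nonincreasing j s t :
  0 <= s -> s <= t -> Delta t j 0 <= Delta s j 0.
Proof.
move=> s0; rewrite le_eqVlt => /predU1P[->//|st]; rewrite -lerN2.
have t0 := le_lt_trans s0 st.
apply: (@abs_cont_ge0_derive_le _ (fun t => - Delta t j 0)); first exact: ltW.
  have := abs_cont_onZ (-1) (ltW st)
    (abs_cont_on_sub s0 (lexx t) (Delta_ac j t0)).
  by under eq_fun do rewrite mulN1r; exact.
apply: ae_lebesgue_impl (Delta_ae j) => u Hu su _.
have u0 := le_lt_trans s0 su; have [k Dk [k0 _]] := Hu u0.
exists (- k); last exact: is_deriveN Dk.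
by rewrite oppr_ge0 k0// Delta_nonneg// ltW.
Qed.

Lemma Delta_cvg : exists2 Dbar : 'cV[R]_(\sum_(v < nagents G) #|sensed v|),
  nonneg Dbar & Delta t @[t --> +oo] --> Dbar.
Proof.
have /choice[L HL] j : exists L : R,
    0 <= L /\ Delta t j 0 @[t --> +oo] --> L.
  have [||L L0 DL] := @nonincreasing_ge0_cvg R (fun t => Delta t j 0).
  - exact: Delta_nonincreasing.
  - by move=> t /Delta_nonneg.
  - by exists L.
exists (\col_j L j); first by move=> j o; rewrite mxE; case: (HL j).
by apply: cvg_mx => j o; rewrite (ord1 o) mxE; case: (HL j).
Qed.

End ConsensusErrors.

(** * The equilibrium conditions *)

(** Derivability along a line on which the function is quadratic. *)
Lemma is_derive_quad {R : realType} k (h : 'cV[R]_k -> R) (z d : 'cV[R]_k)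
    (L q : R) :
  (forall e : R, h (e *: d + z) = h z + e * L + e ^+ 2 * q) ->
  is_derive z d h L.
Proof.
move=> hE; split; last exact: derive_quad hE.
apply/cvg_ex; exists L.
have : (fun e : R => L + e * q) @ (0 : R)^' --> L.
  rewrite -[X in _ --> X]addr0; apply: cvgD; first exact: cvg_cst.
  rewrite -[X in _ --> X](mul0r q); apply: cvgMr_tmp.
  exact: nbhs_dnbhs.
apply: cvg_trans; apply: near_eq_cvg; near=> e.
have e0 : e != 0 by near: e; exact: nbhs_dnbhs_neq.
by rewrite /= hE /GRing.scale/=; field.
Unshelve. all: by end_near. Qed.

Section Equilibrium.
Context {R : realType} {G : game R}.
Local Notation N := (nagents G).
Local Notation n := (\sum_(v < N) ndec v)%N.
Implicit Types (v : 'I_N) (z : 'cV[R]_n).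

(** The rows of A sensed by agent v, restricted to the columns of that agent. *)
Definition own_rows v : 'M[R]_(#|sensed v|, ndec v) :=
  local v (submxrow (Amat G) v).

Lemma local_mul k q v (M : 'M[R]_(ncstr G, k)) (w : 'M[R]_(k, q)) :
  local v (M *m w) = local v M *m w.
Proof.
by apply/matrixP => r j; rewrite !mxE; under [RHS]eq_bigr do rewrite mxE.
Qed.

Lemma localD k v (x y : 'M[R]_(ncstr G, k)) :
  local v (x + y) = local v x + local v y.
Proof. by apply/matrixP => r j; rewrite !mxE. Qed.

(** The multiplier term of the flow decouples between agents because every
    constraint that involves an agent is sensed by it. *)
Lemma multiplier_block v (l : 'cV[R]_(ncstr G)) D :
  submxcol ((Amat G)^T *m l + Dmat G *m D) v =
  (own_rows v)^T *m (local v l + submxcol D v).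
Proof.
rewrite submxcolD mulmxDr; congr (_ + _).
  apply/colP => k; rewrite -submxcol_mul -tr_submxrow !mxE.
  rewrite (bigID (fun i => i \in sensed v)) /= addrC big1 ?add0r => [|i iv].
    rewrite big_enum_val; apply: eq_bigr => r _.
    by rewrite !mxE.
  have /eqP/rowP/(_ k) : row i (submxrow (Amat G) v) == 0.
    by apply: contraNT iv; exact: sensed_relevant.
  by rewrite !mxE => ->; rewrite mul0r.
rewrite -submxcol_mul submxcol_matrix -[D in LHS]submxcolK mul_mxrow_mxcol.
rewrite (bigD1 v)//= eqxx big1 ?addr0// => u uv.
by rewrite eq_sym (negbTE uv) mul0mx.
Qed.

Lemma deviateB v (x : 'cV[R]_(ndec v)) z :
  deviate x z - z = \mxcol_u eqtype.dfwith (fun=> 0) (x - submxcol z v) u.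
Proof.
apply/mxcolP => u; rewrite submxcolB !mxcolK.
have [<-|vu] := eqVneq v u; first by rewrite !eqtype.dfwith_in.
by rewrite !eqtype.dfwith_out// subrr.
Qed.

Lemma lconstr_deviate v (x : 'cV[R]_(ndec v)) z :
  lconstr v (deviate x z) = lconstr v z + own_rows v *m (x - submxcol z v).
Proof.
rewrite /lconstr.
have -> : constr (deviate x z) = constr z + Amat G *m (deviate x z - z).
  by rewrite /constr mulmxBr [RHS]addrC subrKA.
rewrite localD local_mul; congr (_ + _).
rewrite -local_mul deviateB -[Amat G in LHS]submxrowK mul_mxrow_mxcol.
rewrite (bigD1 v)//= eqtype.dfwith_in big1 ?addr0 ?local_mul// => u uv.
by rewrite eqtype.dfwith_out ?mulmx0// eq_sym.
Qed.

Lemma othersD v (y z : 'cV[R]_n) : others v (y + z) = others v y + others v z.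
Proof. by apply/mxcolP => j; rewrite submxcolD !mxcolK submxcolD. Qed.

Lemma othersZ v (e : R) z : others v (e *: z) = e *: others v z.
Proof. by apply/matrixP => k o; rewrite !mxE. Qed.

(** Expansion of the cost of agent v along the line of direction (a, b). *)
Lemma costD v (x a : 'cV[R]_(ndec v)) y b (e : R) :
  cost (e *: a + x) (e *: b + y) = cost x y +
    e * (dot a ((Qmat v + (Qmat v)^T) *m x + Pmat v *m y + rvec v)
         + dot x (Pmat v *m b)) +
    e ^+ 2 * (dot a (Qmat v *m a) + dot a (Pmat v *m b)).
Proof.
have cE u w : cost u w =
    dot u (Qmat v *m u) + dot u (Pmat v *m w) + dot (rvec v) u.
  by rewrite /cost mxE [X in X + _]mxE /dot !mulmxA.
rewrite !cE !mulmxDr mulmxDl -!scalemxAr !(dotDl, dotDr, dotZl, dotZr).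
rewrite dot_trmul (dotC (Qmat v *m a)) (dotC (rvec v) a); ring.
Qed.

Lemma is_derive_fcost v z d : exists L, is_derive z d (fcost v) L.
Proof.
eexists; apply: is_derive_quad => e; rewrite /fcost.
have -> : submxcol (e *: d + z) v = e *: submxcol d v + submxcol z v.
  by rewrite submxcolD; congr (_ + _); apply/matrixP => k o; rewrite !mxE.
by rewrite othersD othersZ costD.
Qed.

Lemma pgrad_lagrangian v z (l : 'cV[R]_#|sensed v|) :
  pgrad v (fun w => lagrangian w l) z =
  pgrad v (fcost v) z + (own_rows v)^T *m l.
Proof.
apply/colP => k; rewrite [RHS]mxE.
have pgE h : pgrad v h z k 0 =
    'D_(delta_mx (tagnat.Rank v k) 0 : 'cV[R]_n) h z by rewrite 2!mxE.
rewrite !pgE; set d := delta_mx _ 0.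
have [L fL] := is_derive_fcost v z d.
have gL : is_derive z d (fun w => ((lconstr v w)^T *m l) 0 0)
    (dot (local v (Amat G *m d)) l).
  apply: (is_derive_quad (q := 0)) => e.
  have -> : lconstr v (e *: d + z) = e *: local v (Amat G *m d) + lconstr v z.
    have -> : e *: local v (Amat G *m d) = local v (e *: (Amat G *m d)).
      by apply/matrixP => r o; rewrite !mxE.
    by rewrite -localD /lconstr /constr mulmxDr -scalemxAr addrA.
  by rewrite -!/(dot _ _) dotDl dotZl mulr0 addr0 addrC.
rewrite [LHS](@derive_val _ _ _ _ _ _ _ (is_deriveD fL gL)).
rewrite [in RHS](@derive_val _ _ _ _ _ _ _ fL); congr (_ + _).
rewrite dotE mxE; apply: eq_bigr => r _; congr (_ * _).
by rewrite -colE !mxE.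
Qed.

Lemma shift_pair_KKT Dbar z l : nonneg Dbar -> shift_pair Dbar z l ->
  KKT z (fun v => local v l + submxcol Dbar v).
Proof.
move=> D0 [stat tight l0] v.
have lc0 : lconstr v z = 0.
  by rewrite /lconstr tight; apply/colP => r; rewrite !mxE.
split.
- rewrite pgrad_lagrangian pgrad_fcost -FmatE -multiplier_block -submxcolD.
  by rewrite addrA stat submxcol0.
- by move=> r o; rewrite !mxE addr_ge0.
- by rewrite lc0 oppr0 => r o; rewrite mxE.
- by rewrite lc0 mulmx0 mxE.
Qed.

(** Every constraint is sensed by some agent. *)
Lemma KKT_feasible z l : KKT z l -> feasible z.
Proof.
move=> kkt i o; rewrite (ord1 o); have [v iv] := sensed_by_some i.
have [_ _ + _] := kkt v => /(_ (enum_rank_in iv i) 0).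
by rewrite !mxE enum_rankK_in.
Qed.

(** In a convex game the KKT system is sufficient. *)
Lemma KKT_GNE z l : (forall v, psd (Qmat v + (Qmat v)^T)) ->
  KKT z l -> GNE z.
Proof.
move=> Qpsd kkt; split=> [|v x xfeas]; first exact: KKT_feasible kkt.
have [stat l0 _ compl] := kkt v.
set xv := submxcol z v; set y := others v z; set a := x - xv.
(* The first order part of the expansion at xv is the gradient, equal to minus
   the constraint part by stationarity; the second order part is convexity. *)
have := costD xv a y 0 1.
rewrite scale1r scaler0 add0r subrK expr1n !mul1r mulmx0 [dot xv 0]dotC.
rewrite [dot a 0]dotC !dot0l !addr0 => ->.
move: stat; rewrite pgrad_lagrangian pgrad_fcost -/xv -/y => /eqP.
rewrite addr_eq0 => /eqP ->; rewrite dotNr dot_trmul.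
have -> : dot (own_rows v *m a) (l v) = dot (lconstr v (deviate x z)) (l v).
  by rewrite lconstr_deviate dotDl [X in X + _]dotC [X in X + _]compl add0r.
have lx : dot (lconstr v (deviate x z)) (l v) <= 0.
  rewrite dotE -oppr_ge0 -sumrN sumr_ge0// => r _; rewrite -mulNr mulr_ge0//.
  by have := xfeas r 0; rewrite mxE.
have := Qpsd v a; rewrite -mulmxA -/(dot a _) mulmxDl dotDr dot_trmul.
by rewrite [dot (_ *m _) _]dotC; lra.
Qed.

End Equilibrium.

Unset Implicit Arguments.

Theorem theorem1 (R : realType) (G : game R)
    (hmon : strongly_monotone (Fmat G))
    (hconv : forall v : 'I_(nagents G), psd (Qmat v + (Qmat v)^T))
    (hlicq : forall v : 'I_(nagents G), LICQ v)
    (hrank : \rank (Amat G) = ncstr G)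
    (hact : Dact G !=set0)
    (z : R -> 'cV[R]_(\sum_(v < nagents G) ndec v))
    (lambda : R -> 'cV[R]_(ncstr G))
    (Delta : R -> 'cV[R]_(\sum_(v < nagents G) #|sensed v|))
    (htraj : trajectory z lambda Delta)
    (hlambda0 : nonneg (lambda 0))
    (hDelta0 : nonneg (Delta 0)) :
  exists Dbar : 'cV[R]_(\sum_(v < nagents G) #|sensed v|),
    [/\ Delta t @[t --> +oo] --> Dbar,
        nonneg Dbar
      & Dact G Dbar ->
        forall zbar lbar, shift_pair Dbar zbar lbar ->
          [/\ z t @[t --> +oo] --> zbar,
              lambda t @[t --> +oo] --> lbar,
              GNE zbar
            & KKT zbar (fun v => local v lbar + submxcol Dbar v)]].
Proof.
have [Dbar D0 DD] := Delta_cvg htraj hDelta0.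
exists Dbar; split=> // _ zbar lbar pair.
have kkt := shift_pair_KKT D0 pair.
have [stat tight lbar0] := pair.
case: htraj => -[zac lac _] l0 _ dyn.
have Afree : row_free (Amat G) by rewrite /row_free hrank.
have w0 : Dmat G *m (Delta t - Dbar) @[t --> +oo] -->
    (0 : 'cV[R]_(\sum_(v < nagents G) ndec v)).
  apply: cvg_mx => i o; rewrite (ord1 o).
  have -> : (fun t => (Dmat G *m (Delta t - Dbar)) i 0) =
      (fun t => dot (row i (Dmat G))^T (Delta t - Dbar)).
    by apply/funext => t; rewrite /dot trmxK -row_mul [in RHS]mxE.
  have -> : (0 : 'cV[R]_(\sum_(v < nagents G) ndec v)) i 0 =
      dot (row i (Dmat G))^T (Dbar - Dbar).
    by rewrite subrr dotC dot0l mxE.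
  by apply: cvg_dot; [exact: cvg_cst | apply: cvgB => //; exact: cvg_cst].
have [|zz ll] := primal_dual_cvg hmon Afree zac lac l0 lbar0 w0 (zbar := zbar).
  apply: ae_lebesgue_impl dyn => t Ht t0; have [zd ld _] := Ht t0; split.
    rewrite (_ : _ - _ = dyn_z (z t) (lambda t) (Delta t))//.
    rewrite /dyn_z -[RHS]addr0 -stat !mulmxBr !opprB.
    by rewrite -!addrA; apply/colP => i; rewrite !mxE; ring.
  rewrite (_ : _ *m _ = constr (z t))//.
  rewrite -[RHS]subr0 -[X in _ = _ - X]tight /constr mulmxBr.
  by rewrite opprB addrA subrK.
by split=> //; exact: KKT_GNE kkt.
Qed.
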